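(* Let $\ell \geq 2$ and let $G$ be a $K_{\ell}$-critical graph with chromatic number $2\ell + 1$. Then $G \cong K_{2\ell+1}$.
   Context: All graphs are finite and simple. For $\ell \geq 2$, a graph $G$ is called $K_{\ell}$-critical if (i) $G$ contains $K_{\ell}$ as a subgraph; (ii) $G$ is critical, i.e. removing any vertex reduces the chromatic number of $G$ by one; (iii) removing the vertex set of any copy of $K_{\ell}$ in $G$ reduces the chromatic number of $G$ by exactly $\ell$. *)

(* Defs.v *)
From mathcomp Require Import all_boot.

Set Implicit Arguments.
Unset Strict Implicit.
Unset Printing Implicit Defensive.

Record sgraph := SGraph {
  vertex :> finType;
  adj : rel vertex;
  adj_sym : symmetric adj;
  adj_irrefl : irreflexive adj
}.

Section Induced.
Variables (G : sgraph) (A : {set G}).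

Definition induced_adj : rel {x : G | x \in A} :=
  fun x y => adj (val x) (val y).

Fact induced_sym : symmetric induced_adj.
Proof. by move=> x y; apply: adj_sym. Qed.

Fact induced_irrefl : irreflexive induced_adj.
Proof. by move=> x; apply: adj_irrefl. Qed.

Definition induced : sgraph := SGraph induced_sym induced_irrefl.

End Induced.

Definition delete (G : sgraph) (S : {set G}) : sgraph := induced (~: S).

Section Complete.
Variable n : nat.

Definition complete_adj : rel 'I_n := fun x y => x != y.

Fact complete_sym : symmetric complete_adj.
Proof. by move=> x y; rewrite /complete_adj eq_sym. Qed.

Fact complete_irrefl : irreflexive complete_adj.
Proof. by move=> x; rewrite /complete_adj eqxx. Qed.

Definition complete : sgraph := SGraph complete_sym complete_irrefl.

End Complete.

(* An embedding of H onto a (not necessarily induced) subgraph of G. *)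
Definition is_copy (H G : sgraph) (f : H -> G) : Prop :=
  injective f /\ forall x y : H, adj x y -> adj (f x) (f y).

Definition contains (G H : sgraph) : Prop := exists f : H -> G, is_copy f.

Definition isomorphic (G H : sgraph) : Prop :=
  exists f : G -> H, bijective f /\ forall x y : G, adj (f x) (f y) = adj x y.

Definition colorable (G : sgraph) (k : nat) : bool :=
  [exists f : {ffun G -> 'I_k}, forall x, forall y, adj x y ==> (f x != f y)].

Fact colorable_card (G : sgraph) : exists k, colorable G k.
Proof.
exists #|G|; apply/existsP; exists [ffun x => enum_rank x].
apply/forallP => x; apply/forallP => y; apply/implyP => xy; rewrite !ffunE.
by apply/eqP => /enum_rank_inj exy; rewrite exy adj_irrefl in xy.
Qed.

Definition chromatic_number (G : sgraph) : nat := ex_minn (colorable_card G).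

(* Drops in the chromatic number are stated additively, since subtraction on
   nat is truncated. *)
Definition critical (G : sgraph) : Prop :=
  forall v : G, chromatic_number (delete [set v]) + 1 = chromatic_number G.

Definition K_critical (l : nat) (G : sgraph) : Prop :=
  [/\ contains G (complete l),
      critical G
    & forall f : complete l -> G, is_copy f ->
        chromatic_number (delete [set f i | i : complete l]) + l =
        chromatic_number G].

(* Main.v *)
(** Colour [G - K] with [l + 1] colours, where [K] is an [l]-clique: every colour
class contains a common neighbour of [K], since otherwise that class could be
merged into the singleton colour classes of [K], giving a [2l]-colouring of [G].
Hence an [l]-th power of a path [s_0, ..., s_(m-1)] can be prolonged until all
common neighbours of [s_0, ..., s_(l-1)] that arise in this way lie on it.  In
any [(l+1)]-colouring the colours along the path are periodic modulo [l + 1], so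
these neighbours occupy all residues; those not congruent to [l] close up an
initial piece that needs [l + 2] colours, whose complement therefore contains no
[l]-clique.  So [l] of them are among the last [l] vertices, and together with
[s_0, ..., s_(l-1)] they form a [2l]-clique [Q].  Exchanging vertices of an
[l]-clique inside [Q] for common neighbours outside [Q] would leave [l + 2]
vertices of [Q] in an [(l+1)]-colourable graph, unless some vertex is adjacent
to all of [Q]; this yields a [(2l+1)]-clique, which is all of [G] by
criticality. *)

Require Import Defs.
From mathcomp Require Import all_boot.
From mathcomp Require Import zify.

Set Implicit Arguments.
Unset Strict Implicit.
Unset Printing Implicit Defensive.

(** * Colourings of vertex subsets, cliques and powers of paths *)

(** Colours are plain naturals and values off [S] are arbitrary, so one function serves for every
    subset of [S] without subtypes. *)
Definition proper_on (G : sgraph) (S : {set G}) (k : nat) (f : G -> nat) : Prop :=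
  {in S, forall x, f x < k} /\ {in S &, forall x y, adj x y -> f x != f y}.

Definition clique (G : sgraph) (Q : {set G}) : Prop :=
  {in Q &, forall x y, x != y -> adj x y}.

Definition power_path (G : sgraph) (l : nat) (x0 : G) (s : seq G) : Prop :=
  uniq s /\ forall i j, i < j -> j <= i + l -> j < size s ->
    adj (nth x0 s i) (nth x0 s j).

Lemma colorable_induced_proper (G : sgraph) (S : {set G}) (k : nat) :
  colorable (induced S) k -> exists f, proper_on S k f.
Proof.
case/existsP=> f /forallP fP.
exists (fun x => if insub x is Some u then val (f u) else 0); split.
  by move=> x xS; rewrite insubT /=.
move=> x y xS yS xy; rewrite !insubT /=.
have /forallP/(_ (Sub y yS))/implyP := fP (Sub x xS).
by apply; rewrite /adj /= /induced_adj /=.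
Qed.

Lemma chromatic_induced (G : sgraph) (S : {set G}) :
  exists f, proper_on S (chromatic_number (induced S)) f.
Proof.
by apply: colorable_induced_proper; rewrite /chromatic_number; case: ex_minnP.
Qed.

Lemma chromatic_number_le (G : sgraph) (k : nat) (f : G -> nat) :
  proper_on [set: G] k f -> chromatic_number G <= k.
Proof.
case=> fk fP; rewrite /chromatic_number; case: ex_minnP => m _; apply.
apply/existsP; exists [ffun x => Ordinal (fk x (in_setT x))].
apply/forallP=> x; apply/forallP=> y; apply/implyP=> xy; rewrite !ffunE.
by rewrite -val_eqE /=; apply: fP.
Qed.

Lemma proper_onS (G : sgraph) (S T : {set G}) (k : nat) (f : G -> nat) :
  S \subset T -> proper_on T k f -> proper_on S k f.
Proof.
move=> /subsetP ST [fk fP]; split=> [x /ST|x y /ST xT /ST yT]; first exact: fk.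
exact: fP.
Qed.

Lemma adj_neq (G : sgraph) (x y : G) : adj x y -> x != y.
Proof. by move=> xy; apply/eqP=> e; rewrite e adj_irrefl in xy. Qed.

Lemma cliqueS (G : sgraph) (P Q : {set G}) : P \subset Q -> clique Q -> clique P.
Proof. by move=> /subsetP PQ cQ x y /PQ xQ /PQ yQ; apply: cQ. Qed.

Lemma cliqueU (G : sgraph) (P Q : {set G}) :
  clique P -> clique Q -> {in P & Q, forall x y, adj x y} -> clique (P :|: Q).
Proof.
move=> cP cQ cPQ x y /setUP[xP|xQ] /setUP[yP|yQ] xy.
- exact: cP.
- exact: cPQ.
- by rewrite adj_sym; apply: cPQ.
- exact: cQ.
Qed.

Lemma cliqueU1 (G : sgraph) (b : G) (Q : {set G}) :
  clique Q -> {in Q, forall x, adj x b} -> clique (b |: Q).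
Proof.
move=> cQ bQ; apply: cliqueU => // [x y|x y].
  by rewrite !inE => /eqP-> /eqP->; rewrite eqxx.
by rewrite inE => /eqP-> yQ; rewrite adj_sym bQ.
Qed.

Lemma uniq_bounded_size (k : nat) (s : seq nat) :
  uniq s -> {in s, forall i, i < k} -> size s <= k.
Proof.
move=> us sk; rewrite -(size_iota 0 k); apply: uniq_leq_size => // i /sk.
by rewrite mem_iota.
Qed.

Lemma clique_proper_card (G : sgraph) (S Q : {set G}) (k : nat) (f : G -> nat) :
  proper_on S k f -> clique Q -> Q \subset S -> #|Q| <= k.
Proof.
move=> fP cQ /proper_onS/(_ fP)[fk fQ].
rewrite cardE -(size_map f); apply: uniq_bounded_size => [|i /mapP[x]].
  rewrite map_inj_in_uniq ?enum_uniq // => x y; rewrite !mem_enum => xQ yQ fxy.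
  apply/eqP/negPn/negP=> xy.
  by have := fQ x y xQ yQ (cQ x y xQ yQ xy); rewrite fxy eqxx.
by rewrite mem_enum => xQ ->; apply: fk.
Qed.

(* Otherwise the colour class of [a] could be distributed over singleton
   classes for the vertices of [K], which saves one colour. *)
Lemma common_neighbor (G : sgraph) (K : {set G}) (m : nat) (f : G -> nat) (a : nat) :
  (forall g, ~ proper_on [set: G] (#|K| + m) g) -> proper_on (~: K) m.+1 f ->
  a <= m -> exists b, [/\ b \notin K, f b = a & {in K, forall x, adj x b}].
Proof.
move=> ncol [fk fP] am.
have [/existsP[b /and3P[bK /eqP fb /forallP bP]]|/existsPn none] :=
  boolP [exists b, [&& b \notin K, f b == a & [forall x, (x \in K) ==> adj x b]]].
  by exists b; split=> // x xK; have := bP x; rewrite xK.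
(* [p v] is the vertex of [K] whose new class receives [v]; the default [v] arises only for a common
   neighbour of [K]. *)
pose p v := if v \in K then v else odflt v [pick x in K | ~~ adj x v].
have pK v : (v \in K) || (f v == a) -> p v \in K.
  rewrite /p; case: ifP => //= vK fva; case: pickP => [x /andP[]//|np].
  have := none v; rewrite vK fva /= negb_forall => /existsP[x].
  by rewrite negb_imply => xP; have := np x; rewrite /= xP.
have pN v : v \notin K -> p v \in K -> ~~ adj (p v) v.
  by rewrite /p => /negPf vK; rewrite vK; case: pickP => [x /andP[]//|_] /=; rewrite vK.
(* Colours below [#|K|] name vertices of [K]; [unbump a] closes the gap left by the class [a], so
   [m] old colours remain. *)
pose h v := if (v \in K) || (f v == a) then index (p v) (enum K)
            else #|K| + unbump a (f v).
case: (ncol h); split.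
  move=> v _; rewrite /h; case: ifP => [/pK pvK|].
    by rewrite ltn_addr // cardE index_mem mem_enum.
  move=> /negbT/norP[vK va]; have := fk v; rewrite inE vK => /(_ isT).
  rewrite /unbump; move: va; lia.
have rng v w : (v \in K) || (f v == a) -> index (p v) (enum K) != #|K| + w.
  by move=> /pK; rewrite -mem_enum -index_mem -cardE; lia.
move=> u v _ _ uv; rewrite /h.
case: ifP => cu; case: ifP => cv.
- apply/eqP=> e; have epp : p u = p v.
    rewrite -(@nth_index _ u (p u) (enum K)) ?mem_enum ?pK // e.
    by rewrite nth_index // mem_enum pK.
  have [uK|uK] := boolP (u \in K); have [vK|vK] := boolP (v \in K).
  + by move: epp (adj_neq uv); rewrite /p uK vK => ->; rewrite eqxx.
  + by move: (pN v vK (pK v cv)); rewrite -epp {1}/p uK uv.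
  + by move: (pN u uK (pK u cu)); rewrite epp {1}/p vK adj_sym uv.
  + move: cu cv; rewrite (negPf uK) (negPf vK) /= => /eqP fu /eqP fv.
    by have := fP u v; rewrite !inE uK vK fu fv eqxx => /(_ isT isT uv).
- exact: rng.
- by rewrite eq_sym; apply: rng.
- move/negbT/norP: cu => [uK ua]; move/negbT/norP: cv => [vK va].
  have := fP u v; rewrite !inE uK vK => /(_ isT isT uv).
  rewrite eqn_add2l; apply: contra => /eqP e; apply/eqP.
  by move: e ua va; rewrite /unbump; lia.
Qed.

(** * Periodicity of colours along a power of a path *)

(** Among [l.+2] consecutive vertices only the two ends may be non-adjacent; with distinct colours
    on the ends, all [l.+2] colours would differ. *)
Lemma power_path_color_step (G : sgraph) (l : nat) (x0 : G) (s : seq G)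
    (S : {set G}) (f : G -> nat) (i : nat) :
  power_path l x0 s -> proper_on S l.+1 f ->
  (forall k, i <= k <= i + l.+1 -> nth x0 s k \in S) -> i + l.+1 < size s ->
  f (nth x0 s i) = f (nth x0 s (i + l.+1)).
Proof.
move=> [us sP] [fk fP] sS ilt; apply/eqP/negPn/negP=> ne.
pose t := [seq f (nth x0 s (i + k)) | k <- iota 0 l.+2].
suff : size t <= l.+1 by rewrite size_map size_iota ltnn.
apply: uniq_bounded_size => [|c /mapP[k]]; last first.
  by rewrite mem_iota => kl ->; apply: fk; apply: sS; lia.
have lt_neq k k' : k < k' -> k' < l.+2 ->
    f (nth x0 s (i + k)) != f (nth x0 s (i + k')).
  move=> kk' k'l; have [d|d] := leqP (k' - k) l.
    by apply: fP; [apply: sS; lia|apply: sS; lia|apply: sP; lia].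
  have -> : k = 0 by lia.
  by have -> : k' = l.+1; [lia|rewrite addn0].
rewrite map_inj_in_uniq ?iota_uniq // => k k'; rewrite !mem_iota /= => kl k'l e.
case: (ltngtP k k') => // kk'; [have := lt_neq k k' kk'|have := lt_neq k' k kk'];
  by rewrite e eqxx => /(_ _)/negP; case; lia.
Qed.

Lemma power_path_color (G : sgraph) (l : nat) (x0 : G) (s : seq G)
    (S : {set G}) (f : G -> nat) (i j : nat) :
  power_path l x0 s -> proper_on S l.+1 f ->
  (forall k, i <= k <= j -> nth x0 s k \in S) -> i <= j -> j < size s ->
  i = j %[mod l.+1] -> f (nth x0 s i) = f (nth x0 s j).
Proof.
move=> sP fP sS ij js /eqP; rewrite eq_sym eqn_mod_dvd // => /dvdnP[q jq].
have {ij jq} jq : j = i + q * l.+1 by lia.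
elim: q j jq sS js => [|q IH] j jq sS js; first by rewrite jq mul0n addn0.
have jE : j = i + q * l.+1 + l.+1 by rewrite jq mulSn; lia.
have ilt : i + q * l.+1 < j by lia.
rewrite (IH _ erefl) ?(ltn_trans ilt) //; last by move=> k kP; apply: sS; lia.
rewrite jE; apply: (power_path_color_step sP fP); last by rewrite -jE.
by move=> k kP; apply: sS; lia.
Qed.

(** * Segments and closed powers of paths *)

Definition segment (G : sgraph) (s : seq G) (a n : nat) : {set G} :=
  [set x in take n (drop a s)].

Lemma segmentP (G : sgraph) (x0 x : G) (s : seq G) (a n : nat) :
  a + n <= size s ->
  reflect (exists2 i, a <= i < a + n & x = nth x0 s i) (x \in segment s a n).
Proof.
move=> ans; have szt : size (take n (drop a s)) = n.
  by rewrite size_takel // size_drop; lia.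
rewrite inE; apply: (iffP (nthP x0)) => [[k kn <-]|[i ai ->]].
  rewrite szt in kn; exists (a + k); first by lia.
  by rewrite nth_take // nth_drop.
exists (i - a); first by rewrite szt; lia.
by rewrite nth_take ?nth_drop; [congr nth; lia|lia].
Qed.

Lemma card_segment (G : sgraph) (s : seq G) (a n : nat) :
  uniq s -> a + n <= size s -> #|segment s a n| = n.
Proof.
move=> us ans; rewrite cardsE (card_uniqP _) ?take_uniq ?drop_uniq //.
by rewrite size_takel // size_drop; lia.
Qed.

Lemma nth_notin_segment (G : sgraph) (x0 : G) (s : seq G) (a n i : nat) :
  uniq s -> a + n <= size s -> i < size s -> (i < a) || (a + n <= i) ->
  nth x0 s i \notin segment s a n.
Proof.
move=> us ans si out; apply/(segmentP x0 _ ans) => -[k kP] /eqP.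
rewrite nth_uniq // => [/eqP ik|]; last by apply: leq_trans ans; lia.
by case/orP: out; lia.
Qed.

Lemma power_path_adj (G : sgraph) (l : nat) (x0 : G) (s : seq G) (i j : nat) :
  power_path l x0 s -> i != j -> i <= j + l -> j <= i + l ->
  i < size s -> j < size s -> adj (nth x0 s i) (nth x0 s j).
Proof.
move=> [_ sP] ne ij ji si sj; case: (ltngtP i j) => [lt|lt|e].
- by apply: sP.
- by rewrite adj_sym; apply: sP.
- by rewrite e eqxx in ne.
Qed.

Lemma clique_segment (G : sgraph) (l : nat) (x0 : G) (s : seq G) (a : nat) :
  power_path l x0 s -> a + l <= size s -> clique (segment s a l).
Proof.
move=> sP als x y /(segmentP x0 _ als)[i iP ->] /(segmentP x0 _ als)[j jP ->] ne.
apply: (power_path_adj sP); try lia.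
by apply: contraNneq ne => ->.
Qed.

Lemma power_path_cons (G : sgraph) (l : nat) (x0 v : G) (s : seq G) :
  power_path l x0 s -> l <= size s -> v \notin s ->
  {in segment s 0 l, forall x, adj x v} -> power_path l x0 (v :: s).
Proof.
move=> [us sP] ls vs vP; split; first by rewrite /= vs.
case=> [|i] [|j] //= ij jl js; last by apply: sP; lia.
rewrite adj_sym; apply: vP; apply/(segmentP x0) => //.
by exists j.
Qed.

(* The colour of a path vertex depends on its position modulo [l.+1].  A common
   neighbour of the first [l] vertices at a position [i] not congruent to [l]
   closes a subgraph on the positions [0..i] that is not [l.+1]-colourable,
   so fewer than [l] positions follow; [l] such neighbours have pairwise
   incongruent positions. *)
Lemma closed_power_path_clique (G : sgraph) (l : nat) (x0 : G) (s : seq G) :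
  (forall g, ~ proper_on [set: G] (l + l) g) ->
  (forall K : {set G}, clique K -> #|K| = l -> exists f, proper_on (~: K) l.+1 f) ->
  power_path l x0 s -> l <= size s ->
  (forall v, {in segment s 0 l, forall x, adj x v} -> v \in s) ->
  exists2 Q : {set G}, clique Q & l + l <= #|Q|.
Proof.
move=> ncol Kcol sP ls closed; have us := sP.1.
have cK := clique_segment (a := 0) sP ls; have kK := card_segment (a := 0) us ls.
have outK k : l <= k -> k < size s -> nth x0 s k \in ~: segment s 0 l.
  by move=> lk ks; rewrite inE; apply: nth_notin_segment => //; rewrite add0n lk orbT.
set K := segment s 0 l in cK kK outK closed; have [f fP] := Kcol K cK kK.
have nbr (c : 'I_l.+1) : exists i : 'I_(size s),
    [/\ l <= i, f (nth x0 s i) = c & {in K, forall x, adj x (nth x0 s i)}].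
  have [|//|b [bK fb bP]] := @common_neighbor _ K l f c _ fP; first by rewrite kK.
    by rewrite -ltnS.
  have bs := closed b bP; have ib : index b s < size s by rewrite index_mem.
  exists (Ordinal ib); rewrite /= nth_index //; split=> //.
  rewrite leqNgt; apply: contra bK => lt; apply/(segmentP x0) => //.
  by exists (index b s); rewrite ?nth_index.
have [idx idxP] := fin_all_exists nbr => {nbr}.
(* Both positions are at least [l], so the stretch between them avoids [K] and periodicity applies
   to [f]. *)
have idx_inj c c' : idx c = idx c' %[mod l.+1] -> c = c'.
  wlog le : c c' / idx c <= idx c' => [H e|e].
    by case: (leqP (idx c) (idx c')) => [/H->//|/ltnW/H->].
  have [lc fc _] := idxP c; have [lc' fc' _] := idxP c'.
  apply: val_inj; rewrite /= -fc -fc'.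
  apply: (power_path_color sP fP) => // k kP; have := ltn_ord (idx c').
  by move=> ?; apply: outK; lia.
pose C := [set c | idx c %% l.+1 != l].
have cardC : l <= #|C|.
  have : #|~: C| <= 1.
    apply/card_le1_eqP => c c'; rewrite !inE !negbK => /eqP e /eqP e'.
    by apply: idx_inj; rewrite e e'.
  by have := cardsC C; rewrite card_ord; lia.
have late c : c \in C -> size s <= idx c + l.
  rewrite inE => cC; rewrite leqNgt; apply/negP=> lt.
  have [lc _ cP] := idxP c; have ils := ltn_ord (idx c).
  (* The last [l] vertices form a clique; without it [g] colours positions [0] to [idx c]
     periodically, although positions [r] and [idx c] are congruent and adjacent. *)
  pose a := size s - l; have al : a + l <= size s by rewrite /a; lia.
  have [g gP] := Kcol _ (clique_segment sP al) (card_segment us al).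
  have outL k : k <= idx c -> nth x0 s k \in ~: segment s a l.
    move=> kc; rewrite inE; apply: nth_notin_segment => //; first lia.
    by rewrite /a; lia.
  set r := idx c %% l.+1 in cC *.
  have rl : r < l by have : r < l.+1 by [exact: ltn_pmod]; lia.
  have : g (nth x0 s r) = g (nth x0 s (idx c)).
    apply: (power_path_color sP gP) => //; last by rewrite modn_mod.
      by move=> k kP; apply: outL; lia.
    by lia.
  apply/eqP; apply: gP.2; [by apply: outL; lia|exact: outL|apply: cP].
  by apply/(segmentP x0) => //; exists r.
pose R := [set nth x0 s (idx c) | c in C].
have cardR : #|R| = #|C|.
  apply: card_in_imset => c c' _ _ e; apply: val_inj.
  by have [_ /= <- _] := idxP c; have [_ /= <- _] := idxP c'; rewrite e.
exists (K :|: R).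
  apply: cliqueU => // [x y /imsetP[c cC ->] /imsetP[c' c'C ->] ne|x y xK].
    (* Both vertices are among the last [l] of the path, hence at distance less than [l] along
       it. *)
    have := late c cC; have := late c' c'C => l1 l2.
    have := ltn_ord (idx c); have := ltn_ord (idx c') => l3 l4.
    apply: (power_path_adj sP); try lia.
    by apply: contraNneq ne => ->.
  by move=> /imsetP[c cC ->]; have [_ _] := idxP c; apply.
rewrite cardsU kK cardR; suff -> : K :&: R = set0 by rewrite cards0; lia.
apply/setP=> x; rewrite !inE; apply/negP=> /andP[xK /imsetP[c _ xE]].
have [_ _ /(_ x)] := idxP c; rewrite -xE inE xK => /(_ isT).
by rewrite adj_irrefl.
Qed.

(** An enumeration of [K] is a first path; common neighbours of its current first [l] vertices are
    prepended until none lies off the path. *)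
Lemma exists_clique_double (G : sgraph) (l : nat) (K : {set G}) :
  0 < l ->
  (forall g, ~ proper_on [set: G] (l + l) g) ->
  (forall K : {set G}, clique K -> #|K| = l -> exists f, proper_on (~: K) l.+1 f) ->
  clique K -> #|K| = l ->
  exists2 Q : {set G}, clique Q & l + l <= #|Q|.
Proof.
move=> l0 ncol Kcol cK kK.
have [x0 x0K] : exists x, x \in K by apply/set0Pn; rewrite -card_gt0 kK.
have : power_path l x0 (enum K) /\ l <= size (enum K).
  rewrite -cardE kK; split=> //; split=> [|i j ij _ js]; first exact: enum_uniq.
  have is_ := ltn_trans ij js.
  apply: cK; [by rewrite -mem_enum mem_nth|by rewrite -mem_enum mem_nth|].
  by rewrite nth_uniq ?enum_uniq // ltn_eqF.
move: (enum K) => s [sP ls] {K cK kK x0K}.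
have [n] := ubnP (#|G| - size s); elim: n s sP ls => // n IH s sP ls nP.
have [/existsP[v /andP[vs /forallP vP]]|/existsPn none] := boolP
  [exists v, (v \notin s) && [forall x, (x \in segment s 0 l) ==> adj x v]].
  have vsP : power_path l x0 (v :: s).
    by apply: power_path_cons => // x xs; have := vP x; rewrite xs.
  apply: (IH _ vsP); first by rewrite /=; lia.
  have vsG : size s < #|G| by rewrite -[_.+1](card_uniqP vsP.1) max_card.
  by rewrite /= subnS prednK ?subn_gt0.
apply: (closed_power_path_clique ncol Kcol sP ls) => v vP.
have := none v; rewrite negb_and negbK => /orP[//|/forallPn[x]].
by rewrite negb_imply => /andP[xs]; rewrite vP.
Qed.

(** * Enlarging the clique by one vertex *)

Lemma subset_of_card (T : finType) (A : {set T}) (n : nat) :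
  n <= #|A| -> exists2 B : {set T}, B \subset A & #|B| = n.
Proof.
move=> nA; exists [set x in take n (enum A)].
  by apply/subsetP=> x; rewrite inE => /mem_take; rewrite mem_enum.
rewrite cardsE (card_uniqP _) ?take_uniq ?enum_uniq //.
by rewrite size_takel // -cardE.
Qed.

Lemma clique_double_extend (G : sgraph) (l : nat) (Q : {set G}) :
  1 < l ->
  (forall g, ~ proper_on [set: G] (l + l) g) ->
  (forall K : {set G}, clique K -> #|K| = l -> exists f, proper_on (~: K) l.+1 f) ->
  clique Q -> #|Q| = l + l ->
  exists2 Q' : {set G}, clique Q' & #|Q'| = (l + l).+1.
Proof.
move=> l1 ncol Kcol cQ kQ.
have [|K KQ kK] := @subset_of_card _ Q l; first by rewrite kQ leq_addr.
have cK := cliqueS KQ cQ; have [f fP] := Kcol K cK kK.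
have kQK : #|Q :\: K| = l by rewrite cardsD (setIidPr KQ) kQ kK; lia.
(* The [l] vertices of [Q :\: K] cannot use all [l.+1] colours; a common neighbour of the missed
   colour lies outside [Q]. *)
have [a al aQ] : exists2 a, a <= l & {in Q :\: K, forall x, f x != a}.
  have [/hasP[a aP /allP aQ]|/hasPn none] :=
    boolP (has (fun a => all (fun x => f x != a) (enum (Q :\: K))) (iota 0 l.+1)).
    exists a; first by move: aP; rewrite mem_iota.
    by move=> x xQ; apply: aQ; rewrite mem_enum.
  have : size (iota 0 l.+1) <= size (map f (enum (Q :\: K))).
    apply: uniq_leq_size (iota_uniq _ _) _ => a /none /allPn[x xQ].
    by rewrite negbK => /eqP<-; apply: map_f.
  by rewrite size_iota size_map -cardE kQK ltnn.
have ncolK (L : {set G}) : #|L| = l -> forall g, ~ proper_on [set: G] (#|L| + l) g.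
  by move=> ->.
have [b [bK fb bP]] := common_neighbor (ncolK K kK) fP al.
have bQ : b \notin Q.
  apply/negP=> bQ; have := aQ b; rewrite inE bK bQ fb => /(_ isT).
  by rewrite eqxx.
have [q qK] : exists q, q \in K by apply/set0Pn; rewrite -card_gt0 kK; lia.
pose K1 := K :\ q; have K1K : K1 \subset K := subD1set K q.
have kK1 : #|K1|.+1 = l by have := cardsD1 q K; rewrite qK kK -/K1 add1n.
have bK1 : b \notin K1 by apply: contra bK; apply: (subsetP K1K).
have cL : clique (b |: K1).
  by apply: cliqueU1 (cliqueS K1K cK) _ => x /(subsetP K1K); apply: bP.
have kL : #|b |: K1| = l by rewrite cardsU1 bK1.
have [/forallP bA|/forallPn[x]] := boolP [forall x, (x \in Q) ==> adj x b].
  exists (b |: Q); last by rewrite cardsU1 bQ kQ.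
  by apply: cliqueU1 => // x xQ; have := bA x; rewrite xQ.
rewrite negb_imply => /andP[xQ xb]; exfalso.
have [f1 f1P] := Kcol _ cL kL.
have xL : x \in ~: (b |: K1).
  rewrite !inE negb_or; apply/andP; split; first by apply: contraNneq bQ => <-.
  by apply: contra xb => /andP[_ xK]; apply: bP.
(* Taking the colour of [x] forces [b1] out of [Q]: inside, it would be [x], which is not adjacent
   to [b], or a neighbour of [x] of equal colour. *)
have [|b1 [b1L fb1 b1P]] := common_neighbor (ncolK _ kL) f1P (a := f1 x).
  by rewrite -ltnS; apply: f1P.1.
have b1Q : b1 \notin Q.
  apply/negP=> b1Q; have ne : x != b1.
    by apply: contraNneq xb => ->; rewrite adj_sym b1P // !inE eqxx.
  have := f1P.2 x b1 xL; rewrite inE b1L fb1 eqxx => /(_ isT).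
  by move/(_ (cQ x b1 xQ b1Q ne)).
(* Here [1 < l] is needed: a second vertex of [K] is exchanged. *)
have [q1 q1K1] : exists q1, q1 \in K1 by apply/set0Pn; rewrite -card_gt0; lia.
pose K2 := K1 :\ q1; have K2K1 : K2 \subset K1 := subD1set K1 q1.
have kK2 : #|K2|.+2 = l by have := cardsD1 q1 K1; rewrite q1K1 -/K2 add1n => <-.
have sL2 : b |: K2 \subset b |: K1 by apply: setUS.
have cL2 : clique (b1 |: (b |: K2)).
  by apply: cliqueU1 (cliqueS sL2 cL) _ => y /(subsetP sL2); apply: b1P.
have kL2 : #|b1 |: (b |: K2)| = l.
  rewrite !cardsU1 (contra (subsetP sL2 b1) b1L) (contra (subsetP K2K1 b) bK1).
  by rewrite -kK2.
have [f2 f2P] := Kcol _ cL2 kL2.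
have K2Q : K2 \subset Q := subset_trans K2K1 (subset_trans K1K KQ).
have sD : Q :\: K2 \subset ~: (b1 |: (b |: K2)).
  apply/subsetP=> y; rewrite !inE => /andP[yK2 yQ].
  rewrite -/K2 !negb_or; apply/and3P; split=> //.
    by apply: contraNneq b1Q => <-.
  by apply: contraNneq bQ => <-.
(* Only [l - 2] vertices of [Q] were deleted, so a clique of [l + 2] vertices would have [l.+1]
   colours. *)
have := clique_proper_card f2P (cliqueS (subsetDl Q K2) cQ) sD.
by rewrite cardsD (setIidPr K2Q) kQ -{1}kK2 -addn2 -addnA addKn ltnn.
Qed.

(** * From the large clique to the whole graph *)

Theorem theorem9 (l : nat) (hl : 2 <= l) (G : sgraph)
    (hcrit : K_critical l G) (hchi : chromatic_number G = 2 * l + 1) :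
  isomorphic G (complete (2 * l + 1)).
Proof.
have [[h [h_inj hP]] crit Kcrit] := hcrit.
have ncol g : ~ proper_on [set: G] (l + l) g.
  by move=> /chromatic_number_le; rewrite hchi; lia.
have Kcol (K : {set G}) : clique K -> #|K| = l ->
    exists f, proper_on (~: K) l.+1 f.
  (* Enumerating [K] makes it a copy of [complete l], so its removal leaves chromatic number
     [2 * l + 1 - l]. *)
  move=> cK kK; pose e (i : complete l) : G := enum_val (cast_ord (esym kK) i).
  have e_inj : injective e by move=> i j /enum_val_inj /cast_ord_inj.
  have eK i : e i \in K by apply: enum_valP.
  have e_copy : is_copy e.
    by split=> // i j ij; apply: cK; rewrite // (inj_eq e_inj).
  have KE : [set e i | i : complete l] = K.
    apply/eqP; rewrite eqEcard card_imset // card_ord kK leqnn andbT.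
    by apply/subsetP=> x /imsetP[i _ ->].
  have := Kcrit e e_copy; rewrite KE hchi => chi.
  have [f] := chromatic_induced (~: K); rewrite -/(delete K).
  have -> : chromatic_number (delete K) = l.+1 by lia.
  by exists f.
have ch : clique [set h i | i : complete l].
  move=> x y /imsetP[i _ ->] /imsetP[j _ ->]; rewrite (inj_eq h_inj).
  exact: hP.
have kh : #|[set h i | i : complete l]| = l by rewrite card_imset // card_ord.
have [Q0 cQ0 kQ0] := exists_clique_double (ltnW hl) ncol Kcol ch kh.
have [Q sQ kQ] := subset_of_card kQ0.
have [Q' cQ' kQ'] := clique_double_extend hl ncol Kcol (cliqueS sQ cQ0) kQ.
have QT : Q' = setT.
  (* Deleting a vertex outside [Q'] would leave this clique of [2 * l + 1] vertices in a graph with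
     a [2 * l]-colouring. *)
  apply/setP=> v; rewrite in_setT; apply/negPn/negP=> vQ.
  have [f fP] := chromatic_induced (~: [set v]); rewrite -/(delete [set v]) in fP.
  have /(clique_proper_card fP cQ') : Q' \subset ~: [set v].
    by apply/subsetP=> x xQ; rewrite !inE; apply: contraNneq vQ => <-.
  by have := crit v; rewrite hchi kQ'; lia.
have kG : #|G| = 2 * l + 1 by rewrite -cardsT -QT kQ'; lia.
pose r (x : G) : complete (2 * l + 1) := cast_ord kG (enum_rank x).
have r_inj : injective r by move=> x y /cast_ord_inj /enum_rank_inj.
exists r; split; first by apply: (inj_card_bij r_inj); rewrite card_ord kG.
move=> x y; rewrite [LHS]/(r x != r y) (inj_eq r_inj).
have [->|ne] := eqVneq x y; first by rewrite adj_irrefl.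
by rewrite cQ' // QT.
Qed.
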